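(* Let $R=\{1,2\}$. Every $\alpha\in[0,2]$ is a jump for $R$. Furthermore, the weak jumps for $R$ are precisely the values \[0,\ \tfrac{k}{k+1}\ (k\ge 1),\ 1,\ 1+\tfrac{k}{4(k+1)}\ (k\ge1),\ \tfrac54,\ \tfrac{2k+1}{k+1}\ (k\ge 1),\ 2,\] i.e. $0,\frac12,\frac23,\dots,1,\frac98,\frac76,\dots,\frac54,\frac32,\frac53,\dots,2$.
   Context: A hypergraph is a pair $H=(V,E)$ with $E\subseteq 2^V$; $H$ is an $R$-graph if $|e|\in R$ for every $e\in E$. For an $R$-graph $H$ on $n$ vertices, $h_n(H)=\sum_{e\in E(H)} 1/\binom{n}{|e|}$. A value $\alpha\in[0,|R|]$ is a jump for $R$ if there exists $c>0$ such that for every $\epsilon>0$ and every integer $t\ge\max R$ there is $n_0$ such that whenever $n\ge n_0$ and $G_n$ is an $R$-graph on $n$ vertices with $h_n(G_n)\ge\alpha+\epsilon$, $G_n$ contains a subgraph $H_t$ on $t$ vertices with $h_t(H_t)\ge\alpha+c$. It is a strong jump for $R$ if there exists $c>0$ such that for every integer $t\ge\max R$ there is $n_0$ such that whenever $n\ge n_0$ and $G_n$ is an $R$-graph on $n$ vertices with $h_n(G_n)\ge\alpha-c$, $G_n$ contains a subgraph $H_t$ on $t$ vertices with $h_t(H_t)\ge\alpha+c$. A weak jump is a jump that is not a strong jump. *)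

(* Defs.v *)
From HB Require Import structures.
From mathcomp Require Export all_boot all_order all_algebra finmap reals.

Set Implicit Arguments.
Unset Strict Implicit.
Unset Printing Implicit Defensive.

Import Order.TTheory GRing.Theory Num.Theory.

Local Open Scope ring_scope.

(* The vertex set is a subset of an ambient finite type, so that a subgraph
   lives on the same type as the graph containing it. *)
Record hypergraph (T : finType) := Hypergraph {
  vertices : {set T};
  edges : {set {set T}};
  edges_sub : edges \subset powerset vertices }.

Definition Rgraph (R : {fset nat}) (T : finType) (H : hypergraph T) : Prop :=
  forall e : {set T}, e \in edges H -> #|e| \in R.

Definition subgraph (T : finType) (H G : hypergraph T) : Prop :=
  vertices H \subset vertices G /\ edges H \subset edges G.

Definition hdensity (K : realType) (T : finType) (H : hypergraph T) : K :=
  \sum_(e in edges H) ('C(#|vertices H|, #|e|)%:R)^-1.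

Definition contains_dense (K : realType) (T : finType) (G : hypergraph T)
    (t : nat) (d : K) : Prop :=
  exists H : hypergraph T,
    [/\ subgraph H G, #|vertices H| = t & d <= hdensity K H].

Definition fset_max (R : {fset nat}) : nat := (\max_(r <- R) r)%N.

Definition jump (K : realType) (R : {fset nat}) (alpha : K) : Prop :=
  0 <= alpha <= (#|` R|%fset)%:R /\
  exists2 c : K, 0 < c &
    forall (eps : K) (t : nat), 0 < eps -> (fset_max R <= t)%N ->
    exists n0 : nat, forall (n : nat) (T : finType) (G : hypergraph T),
      (n0 <= n)%N -> Rgraph R G -> #|vertices G| = n ->
      alpha + eps <= hdensity K G -> contains_dense G t (alpha + c).

Definition strong_jump (K : realType) (R : {fset nat}) (alpha : K) : Prop :=
  0 <= alpha <= (#|` R|%fset)%:R /\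
  exists2 c : K, 0 < c &
    forall t : nat, (fset_max R <= t)%N ->
    exists n0 : nat, forall (n : nat) (T : finType) (G : hypergraph T),
      (n0 <= n)%N -> Rgraph R G -> #|vertices G| = n ->
      alpha - c <= hdensity K G -> contains_dense G t (alpha + c).

Definition weak_jump (K : realType) (R : {fset nat}) (alpha : K) : Prop :=
  jump R alpha /\ ~ strong_jump R alpha.

(* Main.v *)
(** A vertex [x] with [[set x]] an edge is called a loop. Pattern [(p, q)] is a
    complete multipartite graph with [p] parts made of loops and [q] parts
    without; the supremum of its limit densities is [1 - 1/q] for [p = 0],
    [1 + q / (4 (q + 1))] for [p = 1] and [2 - 1/p] for [p >= 2].

    If a large graph has density at least [s + eps], then a positive proportion
    of its [m]-tuples of vertices span a graph of density above [s]. Shifting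
    weights between non-adjacent vertices as in the Motzkin-Straus theorem, such
    a tuple contains a clique whose pattern has value above [s]. By pigeonhole
    one pattern occurs on a positive proportion of the tuples, so Erdos's
    theorem on complete multipartite subhypergraphs gives a large blow-up of it,
    and deleting vertices one at a time preserves the density on average. Hence
    a graph of density at least [s + eps] contains subgraphs of any fixed order
    whose density is at least some pattern value above [s].

    The pattern values form three increasing sequences with limits [1], [5/4]
    and [2]. They are therefore well ordered, which makes every number a jump,
    and a number outside their closure is even a strong jump. Blow-ups of a
    pattern show that its value is not a strong jump, and the set of numbers
    that are not strong jumps is closed. *)

Require Import Defs.
From HB Require Import structures.
From mathcomp Require Import all_boot all_order all_algebra finmap reals.
From mathcomp Require Import boolp ring lra.

Set Implicit Arguments.
Unset Strict Implicit.
Unset Printing Implicit Defensive.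

Import Order.TTheory GRing.Theory Num.Theory.

Local Open Scope ring_scope.

(** * Blow-ups of dense relations *)

Lemma nat_above (K : realType) (x : K) : exists2 n : nat, (0 < n)%N & x <= n%:R.
Proof.
exists (Num.bound `|x|).+1 => //; apply: le_trans (ler_norm x) _.
by apply: le_trans (ltW (archi_boundP (normr_ge0 x))) _; rewrite ler_nat.
Qed.

Lemma sum_indicator (K : realType) (X : finType) (P : pred X) :
  \sum_(x : X) (P x)%:R = #|[pred x | P x]|%:R :> K.
Proof.
rewrite -sum1_card natr_sum [RHS]big_mkcond /=.
by apply: eq_bigr => x _; rewrite inE; case: (P x).
Qed.

(** Markov's inequality in reverse: points with [f x <= c] contribute at most [c], the others at
    most [b]. A large average thus forces many points above [c]. *)
Lemma sum_le_level (K : realType) (X : finType) (f : X -> K) (b c : K) :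
    0 <= c -> (forall x, f x <= b) ->
  \sum_x f x <= c * #|X|%:R + b * \sum_x (c < f x)%R%:R.
Proof.
move=> c0 fb; rewrite mulr_natr -sumr_const mulr_sumr -big_split /=.
apply: ler_sum => x _; case: ltP => h; rewrite ?mulr1 ?mulr0 ?addr0 //.
by have := fb x; lra.
Qed.

Lemma sum_card (K : realType) (X : finType) (c : K) :
  \sum_(x : X) c = #|X|%:R * c.
Proof. by rewrite sumr_const mulr_natl. Qed.

(* Dependent random choice in its crudest form: fix a bounded number [M] of
   vertices of large degree; a positive proportion of [Y] sees [#|J|] of them,
   and only boundedly many choices of these neighbours compete. *)
Lemma common_neighbours (K : realType) (J : finType) (d : K) : 0 < d ->
  exists2 d' : K, 0 < d' & exists n0 : nat,
  forall (X Y : finType) (R : X -> Y -> bool),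
    (n0 <= #|X|)%N -> (0 < #|Y|)%N ->
    d * #|X|%:R * #|Y|%:R <= \sum_x \sum_y (R x y)%:R ->
  exists2 h : J -> X, injective h &
    d' * #|Y|%:R <= \sum_y [forall j, R (h j) y]%:R.
Proof.
move=> d0.
(* This makes [d / 4 * M] at least [#|J|]: a [y] related to more than [d / 4 * M] of the [M] chosen
   vertices admits an injection from [J]. *)
have [M M0 hM] := nat_above (4 * #|J|%:R / d).
have [n0 _ hn0] := nat_above (2 * M%:R / d).
pose F : finType := {ffun J -> 'I_M}.
have F0 : 0 < #|F|%:R :> K by rewrite card_ffun card_ord ltr0n expn_gt0 M0.
exists (d / 8 / #|F|%:R); first by rewrite !divr_gt0.
exists n0 => X Y R hX hY hR.
have Y0 : 0 < #|Y|%:R :> K by rewrite ltr0n.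
have M0' : 0 < M%:R :> K by rewrite ltr0n.
pose deg x : K := \sum_y (R x y)%:R.
(* At least [d / 2 * #|X|] vertices have degree above half the guaranteed average. *)
pose W := [pred x | d / 2 * #|Y|%:R < deg x].
have leW : (M <= #|W|)%N.
  have h0 : 0 <= d / 2 * #|Y|%:R by rewrite mulr_ge0 ?divr_ge0 ?ltW.
  have hb x : deg x <= #|Y|%:R.
    by rewrite -[leRHS]mulr1 -sum_card; apply: ler_sum => y _; case: (R x y).
  have := sum_le_level h0 hb; rewrite sum_indicator => h1.
  have hX' : n0%:R <= #|X|%:R :> K by rewrite ler_nat.
  have hMX : M%:R <= d / 2 * #|X|%:R.
    have : 2 * M%:R / d <= #|X|%:R := le_trans hn0 hX'.
    by rewrite ler_pdivrMr //; lra.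
  have : #|Y|%:R * (d / 2 * #|X|%:R) <= #|Y|%:R * #|W|%:R.
    have := le_trans hR h1; rewrite -/(deg _); lra.
  by rewrite ler_pM2l // => /(le_trans hMX); rewrite ler_nat.
pose u (i : 'I_M) : X := enum_val (widen_ord leW i).
have uI : injective u.
  by move=> i j /enum_val_inj /(congr1 val) /= ij; apply: val_inj.
have udeg i : d / 2 * #|Y|%:R <= deg (u i).
  by have := enum_valP (widen_ord leW i); rewrite inE => /ltW.
pose g y : K := \sum_(i < M) (R (u i) y)%:R.
have leY : d / 4 * #|Y|%:R <= \sum_y (d / 4 * M%:R < g y)%R%:R.
  have h0 : 0 <= d / 4 * M%:R by rewrite mulr_ge0 ?divr_ge0 ?ltW.
  have hb y : g y <= M%:R.
    rewrite -[leRHS]mulr1 -[X in X%:R * _]card_ord -sum_card.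
    by apply: ler_sum => i _; case: (R _ _).
  have h1 := sum_le_level h0 hb.
  have h2 : M%:R * (d / 2 * #|Y|%:R) <= \sum_y g y.
    rewrite exchange_big /= -{1}[M]card_ord -sum_card.
    by apply: ler_sum => i _; apply: udeg.
  by rewrite -(ler_pM2l M0'); lra.
apply: contrapT => noh.
suff : \sum_y (d / 4 * M%:R < g y)%R%:R <= d / 8 * #|Y|%:R.
  by have := mulr_gt0 d0 Y0; move: leY; lra.
(* Union bound: each [y] above the level supports an injection [h], so if no [h] served a proportion
   [d / 8 / #|F|] of [Y], too few [y] would lie above it. *)
pose Q (h : F) y := injectiveb h && [forall j, R (u (h j)) y].
apply: (@le_trans _ _ (\sum_(h : F) \sum_y (Q h y)%:R)).
  rewrite exchange_big /=; apply: ler_sum => y _.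
  case: ltP => [gy|_]; last by apply: sumr_ge0.
  pose N := [pred i | R (u i) y].
  have leJ : (#|J| <= #|N|)%N.
    rewrite -(ler_nat K); apply: le_trans (ltW _); last first.
      by move: gy; rewrite /g sum_indicator; apply.
    by move: hM; rewrite ler_pdivrMr //; lra.
  pose h : F := [ffun j => enum_val (widen_ord leJ (enum_rank j))].
  rewrite (bigD1 h) //= -[leLHS]addr0 lerD ?sumr_ge0 //.
  suff -> : Q h y by [].
  apply/andP; split; last first.
    apply/forallP => j; rewrite ffunE.
    by have := enum_valP (widen_ord leJ (enum_rank j)); rewrite inE.
  apply/injectiveP => i j; rewrite !ffunE => /enum_val_inj /(congr1 val) /= ij.
  by apply: enum_rank_inj; apply: val_inj.
apply: (@le_trans _ _ (\sum_(h : F) d / 8 / #|F|%:R * #|Y|%:R)); last first.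
  by rewrite sum_card mulrA mulrCA divff ?mulr1 // gt_eqF.
apply: ler_sum => h _; rewrite leNgt; apply/negP => lth; apply: noh.
have [hI|hI] := boolP (injectiveb h).
  exists (u \o h); first by apply: inj_comp (uI) _; apply/injectiveP.
  by move: lth; rewrite /Q hI /= => /ltW.
move: lth; rewrite big1 ?ltNge => [|y _]; last by rewrite /Q (negPf hI).
by rewrite mulr_ge0 // !divr_ge0 // ltW.
Qed.

Definition update (I X : finType) (f : {ffun I -> X}) (i : I) (x : X) :
  {ffun I -> X} := [ffun k => if k == i then x else f k].

(* [(x, f)] maps to [(f i, update f i x)] is an involution. *)
Lemma sum_update (K : realType) (I X : finType) (i : I)
    (F : {ffun I -> X} -> K) :
  \sum_x \sum_f F (update f i x) = #|X|%:R * \sum_f F f.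
Proof.
rewrite -sum_card !pair_bigA /=.
pose s (p : X * {ffun I -> X}) := (p.2 i, update p.2 i p.1).
have sK : involutive s.
  move=> [x f]; rewrite /s /= ffunE eqxx; congr (_, _).
  by apply/ffunP => k; rewrite !ffunE; case: eqP => // ->.
by rewrite [RHS](reindex_inj (inv_inj sK)).
Qed.

Definition overwrite (I J X : finType) (s : seq I) (h : I -> J -> X)
    (g : {ffun I -> J}) (f : {ffun I -> X}) : {ffun I -> X} :=
  [ffun i => if i \in s then h i (g i) else f i].

(** Induction on [s]: the functions that work for the coordinates already blown up have positive
    density, so [common_neighbours], applied between values at the next coordinate [i] and
    functions, blows up [i] as well. *)
Lemma blow_up_coordinates (K : realType) (I J : finType) (s : seq I) (d : K) :
  uniq s -> 0 < d -> exists2 d' : K, 0 < d' & exists n0 : nat,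
  forall (X : finType) (P : pred {ffun I -> X}), (n0 <= #|X|)%N ->
    d * #|{ffun I -> X}|%:R <= \sum_f (P f)%:R ->
  exists2 h : I -> J -> X, (forall i, i \in s -> injective (h i)) &
    d' * #|{ffun I -> X}|%:R <=
    \sum_f [forall g : {ffun I -> J}, P (overwrite s h g f)]%:R.
Proof.
move=> + d0; elim: s => [_|i s IHs /= /andP[iNs us]].
  exists d => //; exists 1%N => X P /card_gt0P[x0 _] hP.
  exists (fun _ _ => x0) => //; apply: le_trans hP _.
  apply: ler_sum => f _; rewrite ler_nat.
  case: (boolP (P f)) => // Pf; rewrite lt0b; apply/forallP => g.
  by rewrite (_ : overwrite _ _ _ _ = f) //; apply/ffunP => k; rewrite ffunE.
have [d1 d10 [n1 H1]] := IHs us.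
have [d2 d20 [n2 H2]] := common_neighbours J d10.
exists d2 => //; exists (maxn 1 (maxn n1 n2)) => X P.
rewrite !geq_max => /and3P[X0 hn1 hn2] hP.
have [h hI hQ] := H1 X P hn1 hP.
pose Q f := [forall g : {ffun I -> J}, P (overwrite s h g f)].
have [||hi hiI hi2] := H2 X {ffun I -> X} (fun x f => Q (update f i x)) hn2.
  by rewrite card_ffun expn_gt0 X0.
  by rewrite (sum_update i (fun f => (Q f)%:R)) mulrAC mulrC ler_wpM2l.
exists (fun k => if k == i then hi else h k).
  move=> k; rewrite inE; case: eqP => // _ /=; exact: hI.
apply: le_trans hi2 _; apply: ler_sum => f _; rewrite ler_nat.
case: (boolP [forall j, Q _]) => // /forallP allQ.
rewrite lt0b; apply/forallP => g; have /forallP /(_ g) := allQ (g i).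
congr (P _); apply/ffunP => k; rewrite !ffunE inE.
by case: eqP => [->|//] /=; rewrite (negPf iNs).
Qed.

(* Erdos's theorem on complete multipartite subhypergraphs, for relations. *)
Lemma blow_up_tuples (K : realType) (I J : finType) (d : K) : 0 < d ->
  exists n0 : nat, forall (X : finType) (P : pred {ffun I -> X}),
    (n0 <= #|X|)%N -> d * #|{ffun I -> X}|%:R <= \sum_f (P f)%:R ->
  exists2 h : I -> J -> X, (forall i, injective (h i)) &
    forall g : I -> J, P [ffun i => h i (g i)].
Proof.
move=> d0.
have [d' d'0 [n0 H]] := blow_up_coordinates J (enum_uniq I) d0.
exists n0.+1 => X P hX hP; have [h hI hd] := H X P (ltnW hX) hP.
exists h => [i|g]; first by apply: hI; rewrite mem_enum.
have : 0 < d' * #|{ffun I -> X}|%:R.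
  by rewrite mulr_gt0 // ltr0n card_ffun expn_gt0 (leq_ltn_trans _ hX).
move=> /lt_le_trans /(_ hd); rewrite sum_indicator ltr0n => /card_gt0P[f].
rewrite inE => /forallP /(_ [ffun i => g i]); congr (P _).
by apply/ffunP => i; rewrite !ffunE mem_enum.
Qed.

(** * Average density of random samples *)

Section Sampling.

Variables (K : realType) (X : finType) (A : pred X) (e : rel X).

(** Dividing by [#|I| ^ 2] rather than [#|I| * (#|I| - 1)] makes this the Lagrangian of the sample
    at uniform weights. *)
Definition sample_density (I : finType) (f : {ffun I -> X}) : K :=
  (\sum_i (A (f i))%:R) / #|I|%:R +
  (\sum_i \sum_j (e (f i) (f j))%:R) / #|I|%:R ^+ 2.

Hypothesis eI : irreflexive e.

(** Each [f i], and each pair [(f i, f j)] with [i != j], is uniformly distributed. The diagonal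
    [i = j] contributes nothing, whence the factor [1 - #|I|^-1]. *)
Lemma sum_sample_density (I : finType) : (0 < #|I|)%N -> (0 < #|X|)%N ->
  \sum_(f : {ffun I -> X}) sample_density f =
  #|{ffun I -> X}|%:R *
  ((\sum_x (A x)%:R) / #|X|%:R +
   (1 - #|I|%:R^-1) * ((\sum_x \sum_y (e x y)%:R) / #|X|%:R ^+ 2)).
Proof.
move=> I0 X0; set N := #|{ffun I -> X}|%:R.
have X0' : #|X|%:R != 0 :> K by rewrite pnatr_eq0 -lt0n.
have I0' : #|I|%:R != 0 :> K by rewrite pnatr_eq0 -lt0n.
have sA i : \sum_(f : {ffun I -> X}) (A (f i))%:R
    = N * ((\sum_x (A x)%:R) / #|X|%:R) :> K.
  apply: (mulfI X0'); rewrite -(sum_update i (fun f => (A (f i))%:R)).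
  under eq_bigr do under eq_bigr do rewrite ffunE eqxx.
  under eq_bigr do rewrite sum_card.
  by rewrite -mulr_sumr -/N; field.
have se i j : i != j -> \sum_(f : {ffun I -> X}) (e (f i) (f j))%:R
    = N * ((\sum_x \sum_y (e x y)%:R) / #|X|%:R ^+ 2) :> K.
  move=> ij; apply: (mulfI X0'); apply: (mulfI X0').
  rewrite -(sum_update i (fun f => (e (f i) (f j))%:R)) mulr_sumr.
  have H x : #|X|%:R * (\sum_(f : {ffun I -> X})
      (e (update f i x i) (update f i x j))%:R) = N * \sum_y (e x y)%:R :> K.
    rewrite -(sum_update j
      (fun f => (e (update f i x i) (update f i x j))%:R)) mulr_sumr.
    apply: eq_bigr => y _; rewrite -sum_card; apply: eq_bigr => f _.
    by rewrite !ffunE !eqxx eq_sym (negPf ij).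
  under eq_bigr do rewrite H.
  by rewrite -mulr_sumr; field.
rewrite /sample_density big_split /= -!mulr_suml exchange_big /=.
under eq_bigr do rewrite sA.
rewrite sum_card [X in _ + X / _]exchange_big /=.
set B := (X in (1 - _) * X); set a := (_ / _ : K).
rewrite (eq_bigr (fun=> (#|I|%:R - 1) * (N * B))); last first.
  move=> i _; rewrite exchange_big /= (bigD1 i) //= big1 => [|f _]; last first.
    by rewrite eI.
  rewrite add0r (eq_bigr (fun=> N * B)) => [|j ji]; last first.
    by rewrite se // eq_sym.
  rewrite sumr_const -[LHS]mulr_natl; congr (_ * _).
  rewrite cardC1; move: I0; by case: #|I| => // n _; rewrite -natr1 addrK.
by rewrite sum_card; field.
Qed.

End Sampling.

(** * Lagrangians of graphs with loops *)

Section Lagrangian.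

Variables (K : realType) (I : finType) (A : pred I) (e : rel I).
Hypotheses (eS : symmetric e) (eI : irreflexive e).

Definition lagrangian (x : I -> K) : K :=
  \sum_i (A i)%:R * x i + \sum_i \sum_j (e i j)%:R * (x i * x j).

(** The partial derivative of [lagrangian] in the coordinate [i], [e] being symmetric. *)
Let gradient (x : I -> K) i : K := (A i)%:R + 2 * \sum_j (e i j)%:R * x j.

Let shift (i j : I) (s : K) (x : I -> K) k :=
  x k + s * ((k == i)%:R - (k == j)%:R).

Lemma sum_mul_delta (u : I -> K) (i j : I) :
  \sum_k u k * ((k == i)%:R - (k == j)%:R) = u i - u j.
Proof.
have D (l : I) : \sum_k u k * (k == l)%:R = u l.
  rewrite (bigD1 l) //= eqxx mulr1 big1 ?addr0 // => k /negPf ->.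
  by rewrite mulr0.
by rewrite -(D i) -(D j) -sumrB; apply: eq_bigr => k _; rewrite mulrBr.
Qed.

(* No edge joins [i] and [j], so the quadratic term in [s] vanishes. *)
Lemma lagrangian_shift (i j : I) (s : K) (x : I -> K) : ~~ e i j ->
  lagrangian (shift i j s x) = lagrangian x + s * (gradient x i - gradient x j).
Proof.
move=> eij; pose d k : K := (k == i)%:R - (k == j)%:R.
pose N k : K := \sum_l (e k l)%:R * x l.
have Ed k : \sum_l (e k l)%:R * d l = (e k i)%:R - (e k j)%:R.
  exact: sum_mul_delta.
have linear_part : \sum_k (A k)%:R * shift i j s x k
    = \sum_k (A k)%:R * x k + s * \sum_k (A k)%:R * d k.
  rewrite mulr_sumr -big_split; apply: eq_bigr => k _ /=.
  by rewrite /shift mulrDr mulrCA.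
have quadratic_part :
    \sum_k \sum_l (e k l)%:R * (shift i j s x k * shift i j s x l)
    = \sum_k \sum_l (e k l)%:R * (x k * x l) + s * \sum_k N k * d k
      + s * \sum_k x k * ((e k i)%:R - (e k j)%:R)
      + s * (s * \sum_k ((e k i)%:R - (e k j)%:R) * d k).
  rewrite !mulr_sumr -!big_split; apply: eq_bigr => k _ /=.
  rewrite -Ed /N mulr_suml [x k * _]mulr_sumr mulr_suml !mulr_sumr -!big_split.
  by apply: eq_bigr => l _ /=; rewrite /shift -/(d k) -/(d l); ring.
rewrite /lagrangian linear_part quadratic_part.
rewrite !sum_mul_delta !eI (negPf eij) eS (negPf eij).
have -> : \sum_k x k * ((e k i)%:R - (e k j)%:R) = N i - N j.
  rewrite /N -sumrB; apply: eq_bigr => k _.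
  by rewrite (eS i) (eS j) mulrBr ![_%:R * x k]mulrC.
by rewrite /gradient -/(N i) -/(N j); ring.
Qed.

(** Induction on the size of the support. Along a shift between non-adjacent vertices the Lagrangian
    is affine, so the one with the smaller derivative can hand all its weight to the other and leave
    the support. *)
Lemma motzkin_straus (x : I -> K) : (forall i, 0 <= x i) -> \sum_i x i = 1 ->
  exists y : I -> K, [/\ forall i, 0 <= y i, \sum_i y i = 1,
    lagrangian x <= lagrangian y &
    forall i j, i != j -> y i != 0 -> y j != 0 -> e i j].
Proof.
have [n] := ubnP #|[pred i | x i != 0]|.
elim: n x => // n IHn x /ltnSE suppx x0 x1.
have [all_adj|] := pselect (forall i j, i != j -> x i != 0 -> x j != 0 -> e i j).
  by exists x.
rewrite -existsNE => -[i]; rewrite -existsNE => -[j] /not_implyP[ij].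
move=> /not_implyP[xi /not_implyP[xj /negP eij]].
wlog grad : i j ij xi xj eij / gradient x j <= gradient x i.
  move=> W; have [|/ltW] := leP (gradient x j) (gradient x i); first exact: W.
  by apply: W => //; rewrite 1?eq_sym // eS.
have [|||y [y0 y1 xy ye]] := IHn (shift i j (x j) x).
- apply: leq_trans suppx; apply: proper_card; apply/properP; split.
    apply/subsetP => k; rewrite !inE /shift; apply: contraNN => /eqP xk0.
    have ki : k != i by apply: contraNneq xi => <-; rewrite xk0.
    have kj : k != j by apply: contraNneq xj => <-; rewrite xk0.
    by rewrite xk0 (negPf ki) (negPf kj) subrr mulr0 addr0.
  exists j; rewrite !inE // /shift eqxx (eq_sym j i) (negPf ij) sub0r mulrN1 subrr.
  by rewrite eqxx.
- move=> k; rewrite /shift; have [->|_] := eqVneq k j.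
    by rewrite (eq_sym j i) (negPf ij) sub0r mulrN1 subrr.
  by rewrite subr0 addr_ge0 ?mulr_ge0.
- rewrite big_split /= x1 -mulr_sumr; have := sum_mul_delta (fun=> 1) i j.
  by under eq_bigr do rewrite mul1r; move=> ->; rewrite subrr mulr0 addr0.
exists y; split=> //; apply: le_trans xy; rewrite lagrangian_shift //.
by rewrite lerDl mulr_ge0 // subr_ge0.
Qed.

End Lagrangian.

(* The supremum of the limit densities of complete multipartite graphs with
   [p] parts made of 1-edges and [q] parts without; for [p >= 2] the optimum
   puts no weight on the latter. The value at [p = q = 0] is junk. *)
Definition pattern_value (K : realType) (p q : nat) : K :=
  match p with
  | 0 => 1 - q%:R^-1
  | 1 => 1 + q%:R / (4 * (q%:R + 1))
  | _ => 2 - p%:R^-1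
  end.

(** The parabola lies above its tangent at [c]. Choosing [c] as the optimal weight makes the bound
    sharp. *)
Lemma sum_sqr_tangent (K : realType) (I : finType) (S : {set I}) (y : I -> K)
    (c : K) : 2 * c * \sum_(i in S) y i - c ^+ 2 * #|S|%:R <=
  \sum_(i in S) y i ^+ 2.
Proof.
rewrite -sum1_card natr_sum !mulr_sumr -sumrB; apply: ler_sum => i _.
by have := sqr_ge0 (y i - c); rewrite mulr1; lra.
Qed.

(** The left side is the Lagrangian of a clique with loops on [P], since the off-diagonal products
    sum to [1] minus the squares. Tangents at the optimal weights bound it. *)
Lemma pattern_value_bound (K : realType) (I : finType) (P Q : {set I})
    (y : I -> K) : (forall i, 0 <= y i) ->
    \sum_(i in P) y i + \sum_(i in Q) y i = 1 ->
  \sum_(i in P) y i + 1 - (\sum_(i in P) y i ^+ 2 + \sum_(i in Q) y i ^+ 2) <=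
  pattern_value K #|P| #|Q|.
Proof.
move=> y0; set a := \sum_(i in P) y i; set b := \sum_(i in Q) y i => ab.
have a0 : 0 <= a by apply: sumr_ge0.
have b0 : 0 <= b by apply: sumr_ge0.
have TP := sum_sqr_tangent P y; have TQ := sum_sqr_tangent Q y.
rewrite -/a -/b in TP TQ.
have Q2 : 0 <= \sum_(i in Q) y i ^+ 2 by apply: sumr_ge0 => i _; apply: sqr_ge0.
rewrite /pattern_value; case Pp : #|P| => [|[|p]].
- have aE : a = 0 by rewrite /a (cards0_eq Pp) big_set0.
  have [Q0|Q0] := posnP #|Q|.
    by move: ab; rewrite aE /b (cards0_eq Q0) big_set0; lra.
  have := TP 0; have := TQ #|Q|%:R^-1; rewrite Pp aE.
  have -> : b = 1 by rewrite -ab aE add0r.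
  have Q0' : #|Q|%:R != 0 :> K by rewrite pnatr_eq0 -lt0n.
  have -> : #|Q|%:R^-1 ^+ 2 * #|Q|%:R = #|Q|%:R^-1 :> K by field.
  by lra.
- set q : K := #|Q|%:R; have q0 : 0 <= q by [].
  have q1 : q + 1 != 0 by rewrite gt_eqF // ltr_wpDl.
  (* At the optimum the loop part has weight [(q + 2) / (2 (q + 1))] and every other part
     [1 / (2 (q + 1))]. *)
  have := TP ((q + 2) / (2 * (q + 1))); have := TQ (1 / (2 * (q + 1))).
  rewrite Pp -/q; have -> : b = 1 - a by rewrite -ab addrC addKr.
  set u := \sum_(i in P) _; set v := \sum_(i in Q) _ => hv hu.
  suff -> : 1 + q / (4 * (q + 1)) = a + 1 -
     (2 * ((q + 2) / (2 * (q + 1))) * a - ((q + 2) / (2 * (q + 1))) ^+ 2 * 1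
      + (2 * (1 / (2 * (q + 1))) * (1 - a) - (1 / (2 * (q + 1))) ^+ 2 * q)).
    by lra.
  by field.
- have := TP #|P|%:R^-1; rewrite Pp; set r : K := p.+2%:R.
  have r2 : 2 <= r by rewrite ler_nat.
  have r0 : 0 < r by apply: lt_le_trans r2.
  have -> : r^-1 ^+ 2 * r = r^-1 by rewrite expr2 mulfVK ?gt_eqF.
  have : r^-1 <= 2^-1 by rewrite lef_pV2 ?posrE.
  set w := r^-1 => w2 h.
  (* This product is the slack: with two or more loop parts [w <= 1 / 2], so weight outside [P]
     never helps. *)
  have : 0 <= (1 - a) * (1 - 2 * w) by apply: mulr_ge0; lra.
  by lra.
Qed.

(** The hypothesis puts the Lagrangian at uniform weights above [s]. Motzkin-Straus moves the
    weights to a clique, which its loops split into [P] and [Q]. *)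
Lemma dense_clique (K : realType) (I : finType) (A : pred I) (e : rel I)
    (s : K) : symmetric e -> irreflexive e -> (0 < #|I|)%N ->
    s < (\sum_i (A i)%:R) / #|I|%:R + (\sum_i \sum_j (e i j)%:R) / #|I|%:R ^+ 2 ->
  exists P Q : {set I}, [/\ [disjoint P & Q], (0 < #|P| + #|Q|)%N,
    s < pattern_value K #|P| #|Q|, {in P, forall i, A i} &
    {in P :|: Q &, forall i j, i != j -> e i j}].
Proof.
move=> eS eI I0 hs; have I0' : #|I|%:R != 0 :> K by rewrite pnatr_eq0 -lt0n.
have [||y [y0 y1 xy ye]] := motzkin_straus A eS eI (x := fun=> #|I|%:R^-1 : K).
- by move=> i; rewrite invr_ge0.
- by rewrite sum_card divff.
pose P := [set i | (y i != 0) && A i]; pose Q := [set i | (y i != 0) && ~~ A i].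
have split_sum (F : I -> K) : (forall i, y i = 0 -> F i = 0) ->
    \sum_i F i = \sum_(i in P) F i + \sum_(i in Q) F i.
  move=> F0; rewrite [in RHS]big_mkcond [X in _ = _ + X]big_mkcond -big_split /=.
  apply: eq_bigr => i _; rewrite !inE; case: eqVneq => [/F0 ->|_] /=.
    by rewrite addr0.
  by case: (A i); rewrite ?addr0 ?add0r.
have PQ1 : \sum_(i in P) y i + \sum_(i in Q) y i = 1 by rewrite -split_sum.
exists P, Q; split.
- rewrite -setI_eq0; apply/eqP/setP => i; rewrite !inE.
  by case: (A i); rewrite ?andbF.
- rewrite lt0n addn_eq0; apply/negP => /andP[/eqP P0 /eqP Q0].
  move: PQ1; rewrite (cards0_eq P0) (cards0_eq Q0) !big_set0; lra.
- apply: lt_le_trans (pattern_value_bound y0 PQ1).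
  apply: lt_le_trans hs _.
  have -> : \sum_(i in P) y i + 1 -
      (\sum_(i in P) y i ^+ 2 + \sum_(i in Q) y i ^+ 2) = lagrangian A e y.
    rewrite -split_sum => [|i ->]; last by rewrite expr0n.
    rewrite -addrA; congr (_ + _).
      rewrite [RHS]split_sum => [|i ->]; last by rewrite mulr0.
      rewrite [X in _ = _ + X]big1 ?addr0.
        by apply: eq_bigr => i; rewrite !inE => /andP[_ ->]; rewrite mul1r.
      by move=> i; rewrite !inE => /andP[_ /negPf ->]; rewrite mul0r.
    (* Distinct vertices of the support are adjacent, so the quadratic part is the squared total
       weight minus the diagonal. *)
    transitivity ((\sum_i y i) * (\sum_i y i) - \sum_i y i ^+ 2).
      by rewrite y1 mulr1.
    rewrite mulr_suml -sumrB.
    apply: eq_bigr => i _; rewrite (bigD1 i) //= [RHS](bigD1 i) //= eI mul0r.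
    rewrite mulrDr -expr2 addrAC subrr !add0r mulr_sumr; apply: eq_bigr => j ji.
    have [->|yi] := eqVneq (y i) 0; first by rewrite !mul0r mulr0.
    have [->|yj] := eqVneq (y j) 0; first by rewrite !mulr0.
    have -> : e i j by apply: ye => //; rewrite eq_sym.
    by rewrite mul1r.
  apply: le_trans xy; rewrite /lagrangian -mulr_suml lerD2l.
  rewrite mulr_suml; apply: ler_sum => i _; rewrite mulr_suml.
  by apply: ler_sum => j _; rewrite expr2 invfM.
- by move=> i; rewrite inE => /andP[].
- move=> i j; rewrite !inE -!andb_orr => /andP[yi _] /andP[yj _] ij.
  exact: ye.
Qed.

(** * Densities of {1,2}-graphs *)

Lemma sum_neq_inj (K : realType) (J I : finType) (c : J -> I) : injective c ->
  \sum_w \sum_w' (c w != c w')%:R = #|J|%:R ^+ 2 - #|J|%:R :> K.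
Proof.
move=> cI; rewrite (eq_bigr (fun=> #|J|%:R - 1)) => [|w _].
  by rewrite sum_card; ring.
rewrite -[X in X - 1]mulr1 -sum_card (bigD1 w) //= eqxx add0r [in RHS](bigD1 w) //=.
rewrite [RHS]addrAC subrr add0r.
by apply: eq_bigr => w'; rewrite (inj_eq cI) eq_sym => ->.
Qed.

(** The optimal weights are rational, so fibres of proportional sizes realise them: one point over
    each [i] in [Q] if [P] is empty, one over each [i] in [P] if [#|P| >= 2], and for a single loop
    part [#|Q| + 2] points over it and one over each [i] in [Q]. *)
Lemma pattern_model (K : realType) (I : finType) (P Q : {set I}) :
    [disjoint P & Q] -> (0 < #|P| + #|Q|)%N ->
  exists (J : finType) (c : J -> I),
    [/\ (0 < #|J|)%N, forall w, c w \in P :|: Q &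
    pattern_value K #|P| #|Q| <= (\sum_w (c w \in P)%:R) / #|J|%:R +
      (\sum_w \sum_w' (c w != c w')%:R) / #|J|%:R ^+ 2].
Proof.
move=> PQ PQ0; case Pp : #|P| => [|[|p]].
- have cQ : #|{: {i : I | i \in Q}}| = #|Q| by rewrite card_sig; apply: eq_card.
  have Q0 : (0 < #|Q|)%N by move: PQ0; rewrite Pp.
  have Q0' : #|Q|%:R != 0 :> K by rewrite pnatr_eq0 -lt0n.
  exists {i : I | i \in Q}, val; rewrite cQ; split=> //.
    by move=> [i Qi]; rewrite inE Qi orbT.
  rewrite (sum_neq_inj K val_inj) cQ /= -[leLHS]add0r lerD ?divr_ge0 ?sumr_ge0 //.
  by rewrite le_eqVlt; apply/orP; left; apply/eqP; field.
- have /cards1P[b Pb] : #|P| == 1%N by rewrite Pp.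
  have cQ : #|{: {i : I | i \in Q}}| = #|Q| by rewrite card_sig; apply: eq_card.
  pose c (w : {i : I | i \in Q} + 'I_(#|Q| + 2)) :=
    match w with inl i => val i | inr _ => b end.
  have bQ i : i \in Q -> (i == b) = false.
    move=> Qi; apply: contraTF PQ => /eqP ib.
    by apply/pred0Pn; exists b; rewrite /= Pb inE eqxx -ib.
  exists ({i : I | i \in Q} + 'I_(#|Q| + 2))%type, c.
  rewrite card_sum cQ card_ord; split; first by rewrite addnA addn2.
    by case=> [[i Qi]|w] /=; rewrite inE ?Qi ?orbT // Pb inE eqxx.
  rewrite !big_sumType /=.
  under [X in _ <= _ + (X + _) / _]eq_bigr => i _.
    rewrite big_sumType /=.
    under [X in _ + X]eq_bigr => j _ do rewrite (bQ _ (valP i)).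
    over.
  under [X in _ <= _ + (_ + X) / _]eq_bigr => i _.
    rewrite big_sumType /=.
    under [X in X + _]eq_bigr => j _ do rewrite eq_sym (bQ _ (valP j)).
    under [X in _ + X]eq_bigr => j _ do rewrite eqxx.
    over.
  rewrite big_split /= (sum_neq_inj K val_inj) !sum_card cQ !card_ord.
  rewrite Pb inE eqxx.
  have -> : \sum_(i : {i | i \in Q}) (val i \in [set b])%:R = 0 :> K.
    by rewrite big1 // => i _; rewrite inE (bQ _ (valP i)).
  rewrite !natrD /=; set q : K := #|Q|%:R; have q0 : 0 <= q by [].
  have q1 : q + 1 != 0 by rewrite gt_eqF // ltr_wpDl.
  have q2 : q + (q + 2) != 0 by rewrite gt_eqF // addrA ltr_wpDl // addr_ge0.
  by rewrite le_eqVlt; apply/orP; left; apply/eqP; field; rewrite q1 q2.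
- have cP : #|{: {i : I | i \in P}}| = #|P| by rewrite card_sig; apply: eq_card.
  have P0 : #|P|%:R != 0 :> K by rewrite Pp pnatr_eq0.
  exists {i : I | i \in P}, val; rewrite cP; split=> //; first by rewrite Pp.
    by move=> [i Pi]; rewrite inE Pi.
  rewrite (sum_neq_inj K val_inj) cP -Pp.
  rewrite (eq_bigr (fun=> 1)) => [|[i Pi] _]; last by rewrite /= Pi.
  rewrite sum_card cP [leLHS]/pattern_value Pp -Pp.
  by rewrite le_eqVlt; apply/orP; left; apply/eqP; field.
Qed.

Lemma sum_image (K : realType) (J X : finType) (h : J -> X) (F : X -> K) :
    injective h -> (forall x, x \notin [set h j | j in J] -> F x = 0) ->
  \sum_x F x = \sum_j F (h j).
Proof.
move=> hI F0; rewrite (bigID (mem [set h j | j in J])) /=.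
rewrite [X in _ + X]big1 // addr0 big_imset //=.
by move=> i j _ _; apply: hI.
Qed.

Section TwoGraphs.

Variables (K : realType) (T : finType).
Implicit Types (G H : hypergraph T).

Definition loops G : pred T := fun x => [set x] \in edges G.
Definition adj G : rel T := fun x y => (x != y) && ([set x; y] \in edges G).

Lemma adj_sym G : symmetric (adj G).
Proof. by move=> x y; rewrite /adj eq_sym setUC. Qed.

Lemma adj_irr G : irreflexive (adj G).
Proof. by move=> x; rewrite /adj eqxx. Qed.

Lemma loops_vertices G x : loops G x -> x \in vertices G.
Proof.
by move=> /(subsetP (edges_sub G)); rewrite powersetE sub1set.
Qed.

Lemma adj_vertices G x y : adj G x y -> x \in vertices G.
Proof.
move=> /andP[_ /(subsetP (edges_sub G))].
by rewrite powersetE subUset !sub1set => /andP[].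
Qed.

Lemma sum_singletons (F : {set T} -> K) :
  \sum_x F [set x] = \sum_(e : {set T} | #|e| == 1%N) F e.
Proof.
rewrite (partition_big (fun x => [set x]) (fun e : {set T} => #|e| == 1%N)) /=; last first.
  by move=> x _; rewrite cards1.
apply: eq_bigr => e /cards1P[a ->].
rewrite (eq_bigl (pred1 a)) ?big_pred1_eq // => x /=.
by rewrite (inj_eq set1_inj).
Qed.

Lemma sum_doubletons (F : {set T} -> K) :
  \sum_x \sum_(y | x != y) F [set x; y] = 2 * \sum_(e : {set T} | #|e| == 2%N) F e.
Proof.
rewrite pair_big_dep /=.
rewrite (partition_big (fun p => [set p.1; p.2]) (fun e : {set T} => #|e| == 2%N)) /=;
  last by move=> [x y] /= xy; rewrite cards2 xy.
rewrite mulr_sumr; apply: eq_bigr => e /cards2P[a [b [ab ->]]].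
rewrite (eq_bigr (fun=> F [set a; b])) => [|p /andP[_ /eqP ->] //].
rewrite (eq_bigl (mem [set (a, b); (b, a)])) => [|[x y]].
  by rewrite sumr_const cards2 xpair_eqE (negPf ab) mulr_natl.
rewrite !inE !xpair_eqE /=; apply/andP/orP => [[xy /eqP xyE]|]; last first.
  by move=> [] /andP[/eqP -> /eqP ->]; rewrite 1?[b == a]eq_sym ab ?eqxx //;
     rewrite setUC eqxx.
have : x \in [set a; b] by rewrite -xyE set21.
have : y \in [set a; b] by rewrite -xyE set22.
have : a \in [set x; y] by rewrite xyE set21.
have : b \in [set x; y] by rewrite xyE set22.
rewrite !inE ![_ == x]eq_sym ![_ == y]eq_sym.
move: xy ab; do ![case: eqVneq => //= ?]; subst=> //; rewrite ?eqxx //; by [left|right].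
Qed.

(** A doubleton arises from two ordered pairs, and [n * (n - 1)] is twice the binomial
    coefficient. *)
Lemma hdensityE H : Rgraph [fset 1%N; 2%N]%fset H ->
  let n : K := #|vertices H|%:R in
  hdensity K H = (\sum_x (loops H x)%:R) / n +
                 (\sum_x \sum_y (adj H x y)%:R) / (n * (n - 1)).
Proof.
move=> HR n; rewrite /hdensity (bigID (fun e : {set T} => #|e| == 1%N)) /=.
congr (_ + _).
  rewrite (sum_singletons (fun e => (e \in edges H)%:R)) mulr_suml.
  rewrite big_mkcondl; apply: eq_bigr => e /eqP ->; rewrite bin1 -/n.
  by case: (e \in _); rewrite ?mul1r ?mul0r.
have -> : \sum_x \sum_y (adj H x y)%:R
    = \sum_x \sum_(y | x != y) ([set x; y] \in edges H)%:R :> K.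
  apply: eq_bigr => x _; rewrite [RHS]big_mkcond /=; apply: eq_bigr => y _.
  by rewrite /adj; case: eqP.
rewrite (sum_doubletons (fun e => (e \in edges H)%:R)) mulr_sumr mulr_suml.
rewrite (eq_bigl (fun e : {set T} => (e \in edges H) && (#|e| == 2%N))).
  rewrite big_mkcondl; apply: eq_bigr => e /eqP ->.
  have -> : n * (n - 1) = 2 * 'C(#|vertices H|, 2)%:R.
    rewrite -natrM mul2n bin2 halfK /n; case: #|_| => [|m]; first by rewrite mul0r.
    rewrite -{2}natr1 addrK -natrM; congr _%:R.
    by rewrite oddM /= andNb subn0.
  case: (e \in _); rewrite ?mulr1 ?mulr0 ?mul0r //.
  by rewrite invfM mulrA divff ?mul1r // pnatr_eq0.
move=> e; case: (boolP (e \in edges H)) => //= /HR.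
by rewrite !inE => /orP[] /eqP ->.
Qed.

Lemma subgraph_trans H2 H1 H3 :
  subgraph H1 H2 -> subgraph H2 H3 -> subgraph H1 H3.
Proof.
by move=> [a b] [c d]; split; [apply: subset_trans c|apply: subset_trans d].
Qed.

Lemma Rgraph_subgraph R H G : subgraph H G -> Rgraph R G -> Rgraph R H.
Proof. by move=> [_ HG] GR e /(subsetP HG); apply: GR. Qed.

Definition induced_edges G (U : {set T}) := [set e in edges G | e \subset U].

Lemma induced_edges_sub G (U : {set T}) :
  induced_edges G U \subset powerset U.
Proof. by apply/subsetP => e; rewrite !inE => /andP[]. Qed.

Definition induced G (U : {set T}) := Hypergraph (induced_edges_sub G U).

Lemma induced_subgraph G (U : {set T}) :
  U \subset vertices G -> subgraph (induced G U) G.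
Proof. by split=> //; apply/subsetP => e; rewrite inE => /andP[]. Qed.

Lemma contains_dense_embedding G (J : finType) (h : J -> T) :
    Rgraph [fset 1%N; 2%N]%fset G -> injective h ->
    (forall j, h j \in vertices G) ->
  contains_dense G #|J| ((\sum_j (loops G (h j))%:R) / #|J|%:R +
    (\sum_i \sum_j (adj G (h i) (h j))%:R) / (#|J|%:R * (#|J|%:R - 1)) : K).
Proof.
move=> GR hI hV; pose U := [set h j | j in J].
have UV : U \subset vertices G by apply/subsetP => _ /imsetP[j _ ->].
have cU : #|U| = #|J| by rewrite card_imset.
have sU (F : T -> K) := sum_image (F := F) hI.
exists (induced G U); split=> //; first exact: induced_subgraph.
rewrite hdensityE ?cU; last exact: Rgraph_subgraph (induced_subgraph UV) GR.
have hU j : h j \in U by apply: imset_f.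
rewrite le_eqVlt; apply/orP; left; apply/eqP; congr (_ / _ + _ / _).
  rewrite sU => [|x xU].
    by apply: eq_bigr => j _; rewrite /loops inE sub1set hU andbT.
  by rewrite /loops inE sub1set (negPf xU) andbF.
rewrite sU => [|x xU].
  apply: eq_bigr => i _; rewrite sU => [|y yU].
    by apply: eq_bigr => j _; rewrite /adj inE subUset !sub1set !hU !andbT.
  by rewrite /adj inE subUset !sub1set (negPf yU) !andbF.
rewrite big1 // => y _.
by rewrite /adj inE subUset !sub1set (negPf xU) !andbF.
Qed.

(* The density of a graph is the average of those of its vertex deletions. *)
Lemma contains_dense_pred G (t : nat) (d : K) :
    Rgraph [fset 1%N; 2%N]%fset G -> (2 <= t)%N ->
  contains_dense G t.+1 d -> contains_dense G t d.
Proof.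
move=> GR t2 [H [HG cH dH]]; set V := vertices H in cH.
have HR := Rgraph_subgraph HG GR.
pose D v := induced H (V :\ v).
have DH v : subgraph (D v) H by apply: induced_subgraph; apply: subD1set.
have cD v : v \in V -> #|vertices (D v)| = t.
  by move=> vV; move: (cardsD1 v V); rewrite vV cH => -[].
have sumD : \sum_(v in V) hdensity K (D v) = t.+1%:R * hdensity K H.
  rewrite (eq_bigr (fun v => \sum_(e in edges H | v \notin e)
      ('C(t, #|e|)%:R^-1))) => [|v vV]; last first.
    rewrite /hdensity cD //; apply: eq_bigl => e; rewrite inE.
    apply: andb_id2l => /(subsetP (edges_sub H)); rewrite powersetE => eV.
    by rewrite subsetD1 eV.
  rewrite /hdensity mulr_sumr (exchange_big_dep (mem (edges H))) /=; last first.
    by move=> v e _ /andP[].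
  apply: eq_bigr => e He.
  have eV : e \subset V.
    by have := subsetP (edges_sub H) _ He; rewrite powersetE.
  rewrite (eq_bigl (mem (V :\: e))) => [|v]; last by rewrite !inE He andbC.
  (* Edges have at most two vertices, so [2 <= t] keeps both binomials nonzero. The edge survives
     [t.+1 - #|e|] deletions, exactly the ratio needed. *)
  have et : (#|e| <= t)%N.
    apply: leq_trans t2; have := HR _ He.
    by rewrite !inE => /orP[] /eqP ->.
  rewrite sumr_const cardsD (setIidPr eV) cH -[LHS]mulr_natl.
  have b0 : 'C(t, #|e|)%:R != 0 :> K by rewrite pnatr_eq0 -lt0n bin_gt0.
  have b1 : 'C(t.+1, #|e|)%:R != 0 :> K.
    by rewrite pnatr_eq0 -lt0n bin_gt0 leqW.
  apply/eqP; rewrite eqr_div // -!natrM eqr_nat.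
  by rewrite -mul_bin_down.
apply: contrapT => noD; have : \sum_(v in V) hdensity K (D v) < t.+1%:R * d.
  rewrite -cH mulr_natl -sumr_const; apply: ltr_sum => [|v vV].
    have /card_gt0P[v vV] : (0 < #|V|)%N by rewrite cH.
    by apply/hasP; exists v; rewrite ?mem_index_enum.
  rewrite ltNge; apply/negP => dD; apply: noD.
  by exists (D v); split; [apply: subgraph_trans (DH v) HG|apply: cD|].
by rewrite sumD ltr_pM2l ?ltr0n // ltNge dH.
Qed.

Lemma contains_dense_leq G (t t' : nat) (d d' : K) :
    Rgraph [fset 1%N; 2%N]%fset G -> (2 <= t <= t')%N -> d <= d' ->
  contains_dense G t' d' -> contains_dense G t d.
Proof.
move=> GR /andP[t2 tt'] dd'; rewrite -(subnK tt').
elim: (_ - _)%N => [|m IHm]; last first.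
  rewrite addSn => /contains_dense_pred; move=> /(_ GR) H; apply: IHm.
  by apply: H; rewrite (leq_trans t2) // leq_addl.
by move=> [H [HG cH dH]]; exists H; split=> //; apply: le_trans dd' _.
Qed.

End TwoGraphs.

(** * Patterns in dense graphs *)

Lemma sum_snd (K : realType) (A B : finType) (F : B -> K) :
  \sum_(z : A * B) F z.2 = #|A|%:R * \sum_b F b.
Proof. by rewrite -(pair_bigA _ (fun _ b => F b)) sum_card. Qed.

(** In an [N]-fold blow-up the counts grow to [N * a] and [N ^ 2 * b]. The finite density divides
    the latter by less than [(N * j) ^ 2], so it can only be larger. *)
Lemma blow_up_density (K : realType) (N j a b : K) :
    1 <= N -> 0 < j -> 1 < N * j -> 0 <= b ->
  a / j + b / j ^+ 2 <=
  N * a / (N * j) + N ^+ 2 * b / (N * j * (N * j - 1)).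
Proof.
move=> N1 j0 Nj b0; have N0 : 0 < N by apply: lt_le_trans N1.
rewrite -mulf_div divff ?gt_eqF // mul1r lerD2l.
rewrite ler_pdivrMr ?exprn_gt0 // mulrAC ler_pdivlMr; last first.
  by rewrite mulr_gt0 ?subr_gt0 // mulr_gt0.
rewrite -subr_ge0 (_ : _ - _ = b * (N * j)); last by ring.
by rewrite !mulr_ge0 // ltW.
Qed.

(** Not an induced copy: vertices from [Q] may carry loops too, as extra edges only raise the
    density. *)
Definition matches (T : finType) (G : hypergraph T) (I : finType)
    (P Q : {set I}) (f : I -> T) : bool :=
  [forall i in P, loops G (f i)] &&
  [forall i in P :|: Q, forall j in P :|: Q, (i != j) ==> adj G (f i) (f j)].

(** Erdos's theorem blows every [i] up to a large class; taking [t] vertices for each point of the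
    model from [pattern_model] reaches the value at order [t * #|J|], and averaging descends to
    order [t]. *)
Lemma dense_matches (K : realType) (I : finType) (P Q : {set I}) (d : K)
    (t : nat) : 0 < d -> (2 <= t)%N ->
    [disjoint P & Q] -> (0 < #|P| + #|Q|)%N ->
  exists n0 : nat, forall (T : finType) (G : hypergraph T),
    let X := {x : T | x \in vertices G} in
    Rgraph [fset 1%N; 2%N]%fset G -> (n0 <= #|vertices G|)%N ->
    d * #|{ffun I -> X}|%:R <=
      \sum_(f : {ffun I -> X}) (matches G P Q (fun i => val (f i)))%:R ->
  contains_dense G t (pattern_value K #|P| #|Q|).
Proof.
move=> d0 t2 PQ PQ0; have [J [c [J0 cPQ hc]]] := pattern_model K PQ PQ0.
have [n0 H] := blow_up_tuples I ('I_t * J)%type d0.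
exists n0 => T G X GR hn; have cX : #|{: X}| = #|vertices G|.
  by rewrite card_sig; apply: eq_card.
rewrite -cX in hn => /(H X (fun f => matches G P Q (fun i => val (f i))) hn).
move=> [h hI hg].
have hloop i z : i \in P -> loops G (val (h i z)).
  move=> iP; have /andP[/forall_inP /(_ i iP)] := hg (fun=> z).
  by rewrite ffunE.
have hadj i i' z z' : i \in P :|: Q -> i' \in P :|: Q -> i != i' ->
    adj G (val (h i z)) (val (h i' z')).
  move=> iPQ iPQ' ii'; have /andP[_] := hg (fun k => if k == i then z else z').
  move=> /forall_inP /(_ i iPQ) /forall_inP /(_ i' iPQ') /implyP /(_ ii').
  by rewrite !ffunE eqxx eq_sym (negPf ii').
(* Every class is indexed by all of ['I_t * J], so [z] serves as its own label. Vertices of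
   different classes are adjacent, hence distinct. *)
pose psi (z : 'I_t * J) := val (h (c z.2) z).
have psiI : injective psi.
  move=> z z'; rewrite /psi; have [cc|cc] := eqVneq (c z.2) (c z'.2).
    by rewrite cc => /val_inj /hI.
  by move=> E; have := hadj _ _ z z' (cPQ _) (cPQ _) cc; rewrite E adj_irr.
have psiV z : psi z \in vertices G by apply: (valP (h _ _)).
have cJ : #|{: 'I_t * J}| = (t * #|J|)%N by rewrite card_prod card_ord.
have := contains_dense_embedding K GR psiI psiV; rewrite cJ.
apply: contains_dense_leq => //; first by rewrite t2 leq_pmulr.
apply: le_trans hc _.
have tJ1 : 1 < t%:R * #|J|%:R :> K.
  by rewrite -natrM ltr1n (leq_trans t2) // leq_pmulr.
have -> : (t * #|J|)%:R = t%:R * #|J|%:R :> K by rewrite natrM.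
have b0 : 0 <= \sum_w \sum_w' (c w != c w')%:R :> K.
  by apply: sumr_ge0 => w _; apply: sumr_ge0.
apply: le_trans (blow_up_density _ _ _ tJ1 b0) _.
- by rewrite ler1n (leq_trans _ t2).
- by rewrite ltr0n.
have tJ0 : 0 <= t%:R * #|J|%:R - 1 :> K by rewrite subr_ge0 ltW.
apply: lerD; apply: ler_wpM2r; rewrite ?invr_ge0 ?mulr_ge0 //.
  have -> : t%:R * \sum_w (c w \in P)%:R =
      \sum_(z : 'I_t * J) (c z.2 \in P)%:R :> K.
    by rewrite (sum_snd _ (fun w => (c w \in P)%:R)) card_ord.
  apply: ler_sum => z _; rewrite ler_nat.
  by case: (boolP (c z.2 \in P)) => // /hloop ->.
have -> : t%:R ^+ 2 * \sum_w \sum_w' (c w != c w')%:R =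
    \sum_(z : 'I_t * J) \sum_(z' : 'I_t * J) (c z.2 != c z'.2)%:R :> K.
  under [RHS]eq_bigr do rewrite (sum_snd _ (fun w' => (c _ != c w')%:R)).
  rewrite (sum_snd _ (fun w => _ * \sum_w' (c w != c w')%:R)) -mulr_sumr card_ord.
  by rewrite mulrA.
apply: ler_sum => z _; apply: ler_sum => z' _; rewrite ler_nat.
by case: (boolP (c z.2 != c z'.2)) => // cc; rewrite hadj.
Qed.

Theorem dense_pattern (K : realType) (s eps : K) (t : nat) :
    0 <= s -> 0 < eps -> (2 <= t)%N ->
  exists n0 : nat, forall (T : finType) (G : hypergraph T),
    Rgraph [fset 1%N; 2%N]%fset G -> (n0 <= #|vertices G|)%N ->
    s + eps <= hdensity K G ->
  exists p q : nat, [/\ (0 < p + q)%N, s < pattern_value K p q &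
    contains_dense G t (pattern_value K p q)].
Proof.
move=> s0 eps0 t2; have [m m0 hm] := nat_above (4 / eps).
pose I := 'I_m; have cI : #|{: I}| = m by rewrite card_ord.
pose F : finType := ({set I} * {set I})%type.
have F0 : 0 < #|F|%:R :> K.
  by rewrite ltr0n; apply/card_gt0P; exists (set0, set0).
pose d := eps / 8 / #|F|%:R; have d0 : 0 < d by rewrite !divr_gt0.
pose valid (R : F) := [&& [disjoint R.1 & R.2], (0 < #|R.1| + #|R.2|)%N &
  s < pattern_value K #|R.1| #|R.2|].
(* There are finitely many patterns inside [I], so the maximum of their thresholds serves them
   all. *)
have /choice[N hN] : forall R : F, exists n1 : nat, valid R ->
    forall (T : finType) (G : hypergraph T),
    let X := {x : T | x \in vertices G} in
    Rgraph [fset 1%N; 2%N]%fset G -> (n1 <= #|vertices G|)%N ->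
    d * #|{ffun I -> X}|%:R <=
      \sum_(f : {ffun I -> X}) (matches G R.1 R.2 (fun i => val (f i)))%:R ->
    contains_dense G t (pattern_value K #|R.1| #|R.2|).
  move=> R; have [/and3P[R1 R2 _]|_] := boolP (valid R); last by exists 0%N.
  by have [n1 H] := dense_matches d0 t2 R1 R2; exists n1.
have [n1 n10 hn1] := nat_above (4 / eps).
exists (maxn (maxn 2 n1) (\max_R N R)) => T G GR.
rewrite !geq_max => /andP[/andP[n2 nn1] /bigmax_leqP nN] hG.
pose X := {x : T | x \in vertices G}; set n := #|vertices G| in n2 nn1 nN.
have cX : #|{: X}| = n by rewrite card_sig; apply: eq_card.
have X0 : (0 < #|{: X}|)%N by rewrite cX (leq_trans _ n2).
pose A : pred X := fun x => loops G (val x).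
pose e : rel X := fun x y => adj G (val x) (val y).
have eI : irreflexive e by move=> x; apply: adj_irr.
have eS : symmetric e by move=> x y; apply: adj_sym.
have sX (f : T -> K) : (forall x, x \notin vertices G -> f x = 0) ->
    \sum_x f x = \sum_(x : X) f (val x).
  move=> f0; apply: sum_image => [|x xV]; first exact: val_inj.
  by apply: f0; apply: contraNN xV => xV; apply/imsetP; exists (exist _ x xV).
pose a : K := \sum_x (A x)%:R; pose b : K := \sum_x \sum_y (e x y)%:R.
have hab : hdensity K G = a / n%:R + b / (n%:R * (n%:R - 1)).
  rewrite hdensityE //; congr (_ / _ + _ / _).
    by rewrite sX // => x; case: (boolP (loops G x)) => // /loops_vertices ->.
  rewrite sX => [|x xV]; last first.
    rewrite big1 // => y _; case: (boolP (adj G x y)) => // /adj_vertices.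
    by rewrite (negPf xV).
  apply: eq_bigr => x _; rewrite sX // => y yV.
  rewrite adj_sym; case: (boolP (adj G y (val x))) => // /adj_vertices.
  by rewrite (negPf yV).
have n2' : 2 <= n%:R :> K by rewrite (ler_nat K 2).
(* Replacing [n * (n - 1)] by [n ^ 2] costs at most [1 / n], the diagonal of the sample at most
   [1 / m]; each is at most [eps / 4]. *)
have hsum : s + eps / 2 <= a / n%:R + (1 - m%:R^-1) * (b / n%:R ^+ 2).
  have bn : b <= n%:R * (n%:R - 1).
    rewrite mulrBr mulr1 -expr2 -cX -(sum_neq_inj K (@inj_id X)).
    apply: ler_sum => x _; apply: ler_sum => y _; rewrite ler_nat.
    by case: (eqVneq x y) => [->|_]; [rewrite eI|case: (e x y)].
  have b0 : 0 <= b by apply: sumr_ge0 => x _; apply: sumr_ge0.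
  have nn0 : 0 < n%:R * (n%:R - 1) :> K by apply: mulr_gt0; lra.
  pose r : K := b / (n%:R * (n%:R - 1)).
  have r0 : 0 <= r by rewrite divr_ge0 // ltW.
  have r1 : r <= 1 by rewrite ler_pdivrMr // mul1r.
  have -> : b / n%:R ^+ 2 = (1 - n%:R^-1) * r.
    by rewrite /r; field; rewrite !gt_eqF //; lra.
  have inv_small k : 4 / eps <= k -> 0 <= k^-1 <= eps / 4.
    have ek0 : 0 < 4 / eps by rewrite divr_gt0.
    move=> hk; rewrite invr_ge0 (le_trans (ltW ek0) hk) /= -[eps / 4]invf_div.
    by rewrite lef_pV2 ?posrE // (lt_le_trans ek0).
  have /andP[m0' m1] := inv_small _ hm.
  have /andP[n0' n1'] : 0 <= (n%:R^-1 : K) <= eps / 4.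
    by apply: inv_small; apply: le_trans hn1 _; rewrite ler_nat.
  move: hG; rewrite hab -/r; set u : K := m%:R^-1 in m0' m1 *.
  set v : K := n%:R^-1 in n0' n1' *; set w := a / _ => hG.
  have := mulr_ge0 (mulr_ge0 m0' n0') r0.
  have r1' : 0 <= 1 - r by rewrite subr_ge0.
  have := mulr_ge0 m0' r1'; have := mulr_ge0 n0' r1'.
  by lra.
pose Fn := {ffun I -> X}; pose sd (f : Fn) := sample_density K A e f.
have N0 : 0 < #|{: Fn}|%:R :> K by rewrite ltr0n card_ffun expn_gt0 X0.
(* Sample densities average at least [s + eps / 2] and never exceed [2]. *)
have hgood : eps / 4 * #|{: Fn}|%:R <= \sum_(f : Fn) (s < sd f)%R%:R.
  have sd2 f : sd f <= 2.
    have c0 : 0 < m%:R :> K by rewrite ltr0n.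
    have -> : 2 = 1 + 1 :> K by [].
    rewrite /sd /sample_density cI; apply: lerD.
      rewrite ler_pdivrMr // mul1r -[leRHS]mulr1 -[in leRHS]cI -sum_card.
      by apply: ler_sum => i _; case: (A _).
    rewrite ler_pdivrMr ?exprn_gt0 // mul1r expr2 -[in leRHS]cI -sum_card.
    apply: ler_sum => i _; rewrite -[leRHS]mulr1 -sum_card.
    by apply: ler_sum => j _; case: (e _ _).
  have := sum_le_level s0 sd2; rewrite sum_sample_density ?cI ?cX //; last first.
    by rewrite (leq_trans _ n2).
  have := ler_wpM2l (ltW N0) hsum; rewrite -/a -/b -/Fn /= => h1 h2.
  have := le_trans h1 h2; rewrite -/Fn; set N1 := #|{: Fn}|%:R; lra.
(* Pigeonhole: if each valid pattern matched less than a proportion [d] of the tuples, all together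
   would cover at most [eps / 8] of them. *)
have [R vR hR] : exists2 R, valid R & d * #|{: Fn}|%:R <=
    \sum_(f : Fn) (matches G R.1 R.2 (fun i => val (f i)))%:R.
  apply: contrapT => noR.
  suff : \sum_(f : Fn) (s < sd f)%R%:R <= eps / 8 * #|{: Fn}|%:R.
    by have := mulr_gt0 eps0 N0; move: hgood; lra.
  pose M (R : F) (f : Fn) := valid R && matches G R.1 R.2 (fun i => val (f i)).
  apply: (@le_trans _ _ (\sum_(R : F) \sum_f (M R f)%:R)).
    rewrite exchange_big /=; apply: ler_sum => f _.
    case: ltP => [sf|_]; last by apply: sumr_ge0.
    have [|||P [Q [PQ PQ0 hs PA PQe]]] := dense_clique
        (A := fun i => A (f i)) (e := fun i j => e (f i) (f j)) _ _ _ sf.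
    - by move=> i j; apply: eS.
    - by move=> i; apply: eI.
    - by rewrite cI.
    rewrite (bigD1 (P, Q)) //= -[leLHS]addr0 lerD ?sumr_ge0 //.
    suff -> : M (P, Q) f by [].
    rewrite /M /valid /= PQ PQ0 hs /=; apply/andP; split.
      by apply/forall_inP => i /PA.
    apply/forall_inP => i iPQ; apply/forall_inP => j jPQ; apply/implyP.
    exact: PQe.
  apply: (@le_trans _ _ (\sum_(R : F) d * #|{: Fn}|%:R)); last first.
    by rewrite sum_card /d mulrA mulrCA divff ?mulr1 // gt_eqF.
  apply: ler_sum => R _; rewrite leNgt; apply/negP => ltR; apply: noR; exists R.
    apply: contraTT ltR => vR; rewrite -leNgt big1.
      by rewrite mulr_ge0 // ltW.
    by move=> f _; rewrite /M (negPf vR).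
  by apply: le_trans (ltW ltR) _; apply: ler_sum => f _; rewrite ler_nat /M;
    case: (valid R).
exists #|R.1|, #|R.2|; have /and3P[_ R0 Rs] := vR; split=> //.
by apply: hN hR => //; apply: nN.
Qed.

(** * Blow-ups of patterns *)

Section ColouredGraph.

Variables (K : realType) (T I : finType) (chi : T -> I) (P : {set I}).

(** The complete multipartite graph whose parts are the fibres of [chi], with loops on the parts
    coloured from [P]. *)
Definition coloured_edges : {set {set T}} :=
  [set e | [exists x, (chi x \in P) && (e == [set x])] ||
           [exists x, exists y, (chi x != chi y) && (e == [set x; y])]].

Lemma coloured_edges_sub : coloured_edges \subset powerset [set: T].
Proof. by apply/subsetP => e _; rewrite powersetE subsetT. Qed.

Definition coloured_graph := Hypergraph coloured_edges_sub.

Lemma coloured_graph_Rgraph : Rgraph [fset 1%N; 2%N]%fset coloured_graph.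
Proof.
move=> e; rewrite !inE => /orP[/existsP[x /andP[_ /eqP ->]]|].
  by rewrite cards1.
move=> /existsP[x /existsP[y /andP[xy /eqP ->]]]; rewrite cards2.
by rewrite (contraNneq _ xy) // => ->.
Qed.

Lemma coloured_loops x : loops coloured_graph x = (chi x \in P).
Proof.
rewrite /loops inE; apply/idP/idP => [|xP]; last first.
  by apply/orP; left; apply/existsP; exists x; rewrite xP /=.
move=> /orP[/existsP[y /andP[yP /eqP /set1_inj ->]] //|].
move=> /existsP[a /existsP[b /andP[ab /eqP /(congr1 (fun e => #|pred_of_set e|))]]].
by rewrite cards1 cards2 (contraNneq _ ab) // => ->.
Qed.

Lemma coloured_adj x y : adj coloured_graph x y = (chi x != chi y).
Proof.
rewrite /adj inE; apply/idP/idP => [|xy]; last first.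
  rewrite (contraNneq _ xy) /= => [|-> //]; apply/orP; right.
  by apply/existsP; exists x; apply/existsP; exists y; rewrite xy /=.
move=> /andP[xy /orP[/existsP[z /andP[_ /eqP /(congr1 (fun e => #|pred_of_set e|))]]|]].
  by rewrite cards1 cards2 xy.
move=> /existsP[a /existsP[b /andP[ab /eqP E]]].
have : x \in [set a; b] by rewrite -E set21.
have : y \in [set a; b] by rewrite -E set22.
move: xy; rewrite !inE => xy /orP[] /eqP yE /orP[] /eqP xE.
- by rewrite xE yE eqxx in xy.
- by rewrite xE yE eq_sym.
- by rewrite xE yE.
- by rewrite xE yE eqxx in xy.
Qed.

(** The colour proportions in [H] are weights to which [pattern_value_bound] applies. The error term
    pays for dividing by [t * (t - 1)] instead of [t ^ 2]. *)
Lemma coloured_subgraph_density (H : hypergraph T) :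
    subgraph H coloured_graph -> (2 <= #|vertices H|)%N ->
  hdensity K H <= pattern_value K #|P| #|~: P| + (#|vertices H|%:R - 1)^-1.
Proof.
move=> HG t2; set V := vertices H; set t : K := #|V|%:R.
have t2' : 2 <= t by rewrite (ler_nat K 2).
have t0 : 0 < t by lra.
have HR := Rgraph_subgraph HG coloured_graph_Rgraph.
have [_ /subsetP EH] := HG.
pose z i : K := \sum_(x in V) (chi x == i)%:R; pose y i := z i / t.
have sum_colour (F : I -> K) : \sum_i F i * z i = \sum_(x in V) F (chi x).
  under eq_bigr do rewrite mulr_sumr.
  rewrite exchange_big; apply: eq_bigr => x _ /=; rewrite (bigD1 (chi x)) //=.
  by rewrite eqxx mulr1 big1 ?addr0 // => i /negPf; rewrite eq_sym => ->; rewrite mulr0.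
have tV : \sum_(x in V) 1 = t by rewrite /t -sum1_card natr_sum.
have z1 : \sum_i z i = t.
  by rewrite -tV -(sum_colour (fun=> 1)); apply: eq_bigr => i _; rewrite mul1r.
have loopsV : \sum_x (loops H x)%:R <= \sum_(i in P) z i.
  rewrite [leRHS]big_mkcond (eq_bigr (fun i => (i \in P)%:R * z i)); last first.
    by move=> i _; case: (i \in P); rewrite ?mul1r ?mul0r.
  rewrite sum_colour [leRHS]big_mkcond; apply: ler_sum => x _ /=.
  case: (boolP (loops H x)) => [lx|_]; last by case: ifP.
  rewrite (loops_vertices lx) -coloured_loops.
  by rewrite /loops (EH _ lx).
have adjV : \sum_x \sum_y (adj H x y)%:R <= t ^+ 2 - \sum_i z i ^+ 2.
  under [X in _ - X]eq_bigr do rewrite expr2.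
  rewrite sum_colour expr2 -{1}tV mulr_suml -sumrB [leRHS]big_mkcond.
  apply: ler_sum => x _ /=; case: ifP => [xV|xV]; last first.
    rewrite big1 // => u _; case: (boolP (adj H x u)) => // /adj_vertices.
    by rewrite -/V xV.
  rewrite mul1r -tV -sumrB [leRHS]big_mkcond; apply: ler_sum => u _ /=.
  case: (boolP (adj H x u)) => [xu|_]; last by case: ifP => //; case: eqP; rewrite ?subrr ?subr0.
  have -> : u \in V by apply: (@adj_vertices _ H u x); rewrite adj_sym.
  have : adj coloured_graph x u.
    by move: xu => /andP[xu /EH]; rewrite /adj xu.
  by rewrite coloured_adj eq_sym => /negPf ->; rewrite subr0.
have y0 i : 0 <= y i by rewrite divr_ge0 ?sumr_ge0 // ltW.
have sC (F : I -> K) : \sum_(i in P) F i + \sum_(i in ~: P) F i = \sum_i F i.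
  rewrite [RHS](bigID (mem P)) /=; congr (_ + _).
  by apply: eq_bigl => i; rewrite inE.
have y1 : \sum_(i in P) y i + \sum_(i in ~: P) y i = 1.
  by rewrite sC -mulr_suml z1 divff ?gt_eqF.
have := pattern_value_bound y0 y1.
rewrite sC /= -mulr_suml; set a := \sum_(i in P) z i in loopsV *.
set S := \sum_i y i ^+ 2 => hpv.
have SE : \sum_i z i ^+ 2 = t ^+ 2 * S.
  rewrite mulr_sumr; apply: eq_bigr => i _; rewrite /y.
  by field; rewrite gt_eqF.
rewrite SE in adjV; have S0 : 0 <= S by apply: sumr_ge0 => i _; apply: sqr_ge0.
rewrite hdensityE // -/V -/t.
set l : K := \sum_x _; set m : K := (X in X / (t * _)).
have m0 : 0 <= m by apply: sumr_ge0 => x _; apply: sumr_ge0.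
have hl : l / t <= a / t by rewrite ler_pM2r ?invr_gt0.
have hm : m / (t * (t - 1)) <= (1 - S) + (t - 1)^-1.
  rewrite ler_pdivrMr ?mulr_gt0 //; last by lra.
  have -> : (1 - S + (t - 1)^-1) * (t * (t - 1)) = t ^+ 2 - t ^+ 2 * S + t * S.
    by field; rewrite gt_eqF //; lra.
  by have := mulr_ge0 (ltW t0) S0; have : m <= _ := adjV; lra.
by lra.
Qed.

End ColouredGraph.

Lemma fset_max12 : fset_max [fset 1%N; 2%N]%fset = 2%N.
Proof. by rewrite /fset_max big_fsetU1 ?inE //= big_seq_fset1. Qed.

Lemma card_fset12 : #|` [fset 1%N; 2%N]%fset| = 2%N.
Proof. by rewrite cardfs2. Qed.

(** Arbitrarily large blow-ups of the model reach the value, whereas their subgraphs of order [m.+2]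
    exceed it by at most [1 / (m + 1) < c]. *)
Lemma pattern_value_not_strong (K : realType) (p q : nat) : (0 < p + q)%N ->
  ~ strong_jump [fset 1%N; 2%N]%fset (pattern_value K p q).
Proof.
move=> pq0 [_ [c c0 H]].
pose I : finType := ('I_p + 'I_q)%type; pose P : {set I} := [set inl i | i in 'I_p].
have cP : #|P| = p by rewrite card_imset ?card_ord // => i j [].
have cPC : #|~: P| = q.
  by rewrite cardsCs setCK cP card_sum !card_ord addKn.
have PC : [disjoint P & ~: P] by rewrite -setI_eq0 setICr.
have [|J [col [J0 _ hJ]]] := pattern_model K PC; first by rewrite cP cPC.
rewrite cP cPC in hJ.
have [m m0 hm] := nat_above (2 / c).
have [|n0 Hn] := H m.+2; first by rewrite fset_max12.
pose T : finType := ('I_n0.+2 * J)%type; pose chi (x : T) := col x.2.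
pose G := coloured_graph chi P.
have cT : #|vertices G| = (n0.+2 * #|J|)%N by rewrite cardsT card_prod card_ord.
have [|| Hs [HG cH hH]] := Hn _ T G _ (@coloured_graph_Rgraph _ _ chi P) cT.
- by rewrite (leq_trans (leqW (leqW (leqnn n0)))) // leq_pmulr.
- apply: le_trans (_ : pattern_value K p q <= _); first by rewrite gerBl ltW.
  rewrite hdensityE ?cT; last exact: coloured_graph_Rgraph.
  have b0 : 0 <= \sum_w \sum_w' (col w != col w')%:R :> K.
    by apply: sumr_ge0 => w _; apply: sumr_ge0.
  apply: le_trans hJ _.
  apply: le_trans (@blow_up_density K n0.+2%:R _ _ _ _ _ _ b0) _.
  + by rewrite ler1n.
  + by rewrite ltr0n.
  + by rewrite -natrM ltr1n (leq_trans _ (leq_pmulr _ J0)).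
  rewrite natrM.
  have -> : \sum_x (loops G x)%:R = n0.+2%:R * \sum_w (col w \in P)%:R :> K.
    under eq_bigr do rewrite coloured_loops.
    by rewrite (sum_snd _ (fun w => (col w \in P)%:R)) card_ord.
  have -> : \sum_x \sum_y (adj G x y)%:R =
      n0.+2%:R ^+ 2 * \sum_w \sum_w' (col w != col w')%:R :> K.
    under eq_bigr do under eq_bigr do rewrite coloured_adj.
    under eq_bigr do rewrite (sum_snd _ (fun w' => (col _ != col w')%:R)).
    rewrite (sum_snd _ (fun w => _ * \sum_w' (col w != col w')%:R)) -mulr_sumr.
    by rewrite card_ord mulrA.
  by [].
have := coloured_subgraph_density K HG; rewrite cH cP cPC => /(_ isT).
have -> : m.+2%:R - 1 = m.+1%:R :> K by rewrite -natr1 addrK.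
move=> /(le_trans hH); rewrite lerD2l.
have : m.+1%:R^-1 < c; last by move=> lt le; have := le_lt_trans le lt; rewrite ltxx.
have c1 : 0 < c^-1 by rewrite invr_gt0.
by rewrite -[ltRHS]invrK ltf_pV2 ?posrE // -natr1; lra.
Qed.

(** A strong jump at [alpha] with constant [c] would give one with constant [c / 2] at every [v]
    within [c / 2] of [alpha]. *)
Lemma not_strong_jump_closed (K : realType) (alpha : K) :
    (forall d, 0 < d -> exists2 v : K,
      alpha - d <= v <= alpha + d &
      0 <= v <= 2 /\ ~ strong_jump [fset 1%N; 2%N]%fset v) ->
  ~ strong_jump [fset 1%N; 2%N]%fset alpha.
Proof.
move=> near [_ [c c0 H]]; have c2 : 0 < c / 2 by rewrite divr_gt0.
have [v /andP[v1 v2] [v02]] := near _ c2; apply; split; first by rewrite card_fset12.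
exists (c / 2) => // t ht; have [n0 Hn] := H t ht; exists n0 => n T G nn GR cG hG.
have [|L [LG cL hL]] := Hn n T G nn GR cG; first by lra.
by exists L; split=> //; apply: le_trans hL; lra.
Qed.

(** * Jumps *)

(** The pattern values form three such sequences; the offset [j] lets the third start at two loop
    parts. *)
Definition approach (K : realType) (L b : K) (j k : nat) : K :=
  L - b / (k + j.+1)%:R.

Section Approach.

Variables (K : realType) (L b : K) (j : nat).
Hypothesis b0 : 0 < b.

Lemma approach_homo (k k' : nat) :
  (k <= k')%N -> approach L b j k <= approach L b j k'.
Proof.
move=> kk'; rewrite lerD2l lerN2 ler_pM2l // lef_pV2 ?posrE ?ltr0n ?addnS //.
by rewrite ler_nat ltnS leq_add2r.
Qed.

Lemma approach_lt (k : nat) : approach L b j k < L.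
Proof. by rewrite gtrBl divr_gt0 // ltr0n addnS. Qed.

Lemma approach_cvg (x : K) : x < L -> exists k, x < approach L b j k.
Proof.
move=> xL; have [k _ hk] := nat_above (b / (L - x)); exists k.
have Lx : 0 < L - x by rewrite subr_gt0.
have k0 : 0 < (k + j.+1)%:R :> K by rewrite ltr0n addnS.
rewrite ltrBrDr -ltrBrDl ltr_pdivrMr // mulrC -ltr_pdivrMr //.
by apply: le_lt_trans hk _; rewrite ltr_nat addnS ltnS leq_addr.
Qed.

(** The sequence increases, so the first term above [alpha], if there is one, is also the least. *)
Lemma approach_gap_above (alpha : K) : exists2 c : K, 0 < c &
  forall k, alpha < approach L b j k -> alpha + c <= approach L b j k.
Proof.
have [ex|nex] := EM (exists k, alpha < approach L b j k); last first.
  by exists 1 => // k hk; case: nex; exists k.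
case: (ex_minnP ex) => k hk kmin.
exists (approach L b j k - alpha); first by rewrite subr_gt0.
by move=> k' /kmin kk'; rewrite addrC subrK approach_homo.
Qed.

(** Below the limit, only finitely many terms are at most [alpha], and the last of them is the
    largest. Above the limit, the distance to [L] is a gap. *)
Lemma approach_gap_below (alpha : K) : alpha <> L ->
    (forall k, alpha <> approach L b j k) -> exists2 c : K, 0 < c &
  forall k, approach L b j k <= alpha -> approach L b j k <= alpha - c.
Proof.
move=> /eqP aL au; have [aL'|La] := ltP alpha L; last first.
  have La' : L < alpha by rewrite lt_neqAle eq_sym aL.
  exists (alpha - L); first by rewrite subr_gt0.
  by move=> k _; rewrite opprB addrC subrK ltW // approach_lt.
case: (ex_minnP (approach_cvg aL')) => k hk kmin.
have below k' : approach L b j k' <= alpha -> (k' < k)%N.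
  move=> hk'; rewrite ltnNge; apply/negP => /approach_homo.
  by move=> /(lt_le_trans hk) /lt_le_trans /(_ hk'); rewrite ltxx.
case: k hk kmin below => [|k] hk kmin below.
  by exists 1 => // k' /below.
exists (alpha - approach L b j k).
  rewrite subr_gt0 lt_neqAle; apply/andP; split.
    by apply/eqP => E; apply: (au k).
  by rewrite leNgt; apply/negP => /kmin; rewrite ltnn.
by move=> k' /below kk'; rewrite opprB addrC subrK approach_homo.
Qed.

End Approach.

(** * Pattern values and the classification of jumps *)

Section JumpsOneTwo.

Variable K : realType.
Implicit Types alpha : K.

Local Notation lower := (approach (1 : K) 1 0).
Local Notation middle := (approach (5 / 4 : K) (1 / 4) 0).
Local Notation upper := (approach (2 : K) 1 1).

Lemma pattern_value_lower q : pattern_value K 0 q.+1 = lower q.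
Proof. by rewrite /approach addn1 div1r. Qed.

Lemma pattern_value_middle q : pattern_value K 1 q = middle q.
Proof.
rewrite /approach addn1 /pattern_value -natr1; field.
by rewrite nat1r pnatr_eq0.
Qed.

Lemma pattern_value_upper p q : pattern_value K p.+2 q = upper p.
Proof. by rewrite /approach addn2 div1r. Qed.

Lemma pattern_valueP p q : (0 < p + q)%N ->
  exists k, pattern_value K p q \in [:: lower k; middle k; upper k].
Proof.
case: p => [|[|p]] pq0.
- case: q pq0 => // q _; exists q.
  by rewrite pattern_value_lower !inE eqxx.
- by exists q; rewrite pattern_value_middle !inE eqxx orbT.
- by exists p; rewrite pattern_value_upper !inE eqxx !orbT.
Qed.

Lemma pattern_value_gap_above alpha : exists2 c : K, 0 < c &
  forall p q, (0 < p + q)%N -> alpha < pattern_value K p q ->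
    alpha + c <= pattern_value K p q.
Proof.
have [c1 c10 h1] := approach_gap_above 1 0 ltr01 alpha.
have q0 : 0 < 1 / 4 :> K by rewrite divr_gt0.
have [c2 c20 h2] := approach_gap_above (5 / 4) 0 q0 alpha.
have [c3 c30 h3] := approach_gap_above 2 1 ltr01 alpha.
exists (Num.min c1 (Num.min c2 c3)); first by rewrite !lt_min c10 c20 c30.
move=> p q /pattern_valueP[k]; rewrite !inE.
by move=> /or3P[] /eqP -> => [/h1|/h2|/h3]; apply: le_trans;
  rewrite lerD2l !ge_min lexx ?orbT.
Qed.

(** Density above [alpha] forces a pattern value above [alpha], hence one at least [alpha + c], with
    [c] independent of [eps] and [t]. *)
Lemma jump12 alpha : 0 <= alpha <= 2 -> jump [fset 1%N; 2%N]%fset alpha.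
Proof.
move=> a02; split; first by rewrite card_fset12.
have [c c0 hc] := pattern_value_gap_above alpha; exists c => // eps t eps0.
rewrite fset_max12 => t2; have /andP[a0 _] := a02.
have [n0 H] := dense_pattern a0 eps0 t2; exists n0 => n T G nn GR cG hG.
have [|p [q [pq0 apq]]] := H T G GR _ hG; first by rewrite cG.
by apply: contains_dense_leq; rewrite ?t2 //= hc.
Qed.

Definition critical alpha : Prop :=
  alpha = 0
  \/ (exists2 k : nat, (1 <= k)%N & alpha = k%:R / (k%:R + 1))
  \/ alpha = 1
  \/ (exists2 k : nat, (1 <= k)%N & alpha = 1 + k%:R / (4 * (k%:R + 1)))
  \/ alpha = 5 / 4
  \/ (exists2 k : nat, (1 <= k)%N & alpha = (2 * k%:R + 1) / (k%:R + 1))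
  \/ alpha = 2.

Lemma lowerE k : lower k = k%:R / (k%:R + 1).
Proof. by rewrite /approach addn1 -natr1; field; rewrite ?nat1r ?natr1 pnatr_eq0. Qed.

Lemma middleE k : middle k = 1 + k%:R / (4 * (k%:R + 1)).
Proof. by rewrite /approach addn1 -natr1; field; rewrite ?nat1r ?natr1 pnatr_eq0. Qed.

Lemma upperE k : upper k = (2 * k.+1%:R + 1) / (k.+1%:R + 1).
Proof.
rewrite /approach addn2 -[k.+2%:R]natr1; field.
by rewrite nat1r natr1 pnatr_eq0.
Qed.

(** At index [0] the sequences start with [0], [1] and [3 / 2]; the last is the entry [k = 1] of its
    family, so that index is shifted by one. *)
Lemma criticalP alpha : critical alpha <->
  (exists k, alpha \in [:: lower k; middle k; upper k]) \/
  alpha \in [:: 1; 5 / 4; 2].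
Proof.
split.
  move=> [->|[[k _ ->]|[->|[[k _ ->]|[->|[[[|k] // _ ->]|->]]]]]].
  - by left; exists 0%N; rewrite lowerE mul0r !inE eqxx.
  - by left; exists k; rewrite lowerE !inE eqxx.
  - by right; rewrite !inE eqxx.
  - by left; exists k; rewrite middleE !inE eqxx orbT.
  - by right; rewrite !inE eqxx orbT.
  - by left; exists k; rewrite upperE !inE eqxx !orbT.
  - by right; rewrite !inE eqxx !orbT.
move=> [[k]|]; rewrite !inE => /or3P[] /eqP ->; rewrite /critical.
- rewrite lowerE; case: k => [|k]; first by left; rewrite mul0r.
  by right; left; exists k.+1.
- rewrite middleE; case: k => [|k]; first by do 2!right; left; rewrite mul0r addr0.
  by do 3!right; left; exists k.+1.
- by rewrite upperE; do 5!right; left; exists k.+1.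
- by do 2!right; left.
- by do 4!right; left.
- by do 6!right.
Qed.

Lemma pattern_value_gap_below alpha : ~ critical alpha -> exists2 c : K, 0 < c &
  forall p q, (0 < p + q)%N -> pattern_value K p q <= alpha ->
    pattern_value K p q <= alpha - c.
Proof.
move=> /criticalP /not_orP[/forallNP nk nL].
have nL' (x : K) : x \in [:: 1; 5 / 4; 2] -> alpha <> x by move=> h E; rewrite E in nL.
have nk' k (x : K) : x \in [:: lower k; middle k; upper k] -> alpha <> x.
  by move=> h E; apply: (nk k); rewrite E.
have q0 : 0 < 1 / 4 :> K by rewrite divr_gt0.
have [||c1 c10 h1] := @approach_gap_below K 1 1 0 ltr01 alpha.
- by apply: nL'; rewrite !inE eqxx.
- by move=> k; apply: (nk' k); rewrite !inE eqxx.
have [||c2 c20 h2] := @approach_gap_below K (5 / 4) (1 / 4) 0 q0 alpha.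
- by apply: nL'; rewrite !inE eqxx orbT.
- by move=> k; apply: (nk' k); rewrite !inE eqxx orbT.
have [||c3 c30 h3] := @approach_gap_below K 2 1 1 ltr01 alpha.
- by apply: nL'; rewrite !inE eqxx !orbT.
- by move=> k; apply: (nk' k); rewrite !inE eqxx !orbT.
exists (Num.min c1 (Num.min c2 c3)); first by rewrite !lt_min c10 c20 c30.
move=> p q /pattern_valueP[k]; rewrite !inE.
by move=> /or3P[] /eqP -> => [/h1|/h2|/h3] /le_trans; apply;
  rewrite lerD2l lerN2 !ge_min lexx ?orbT.
Qed.

(** Density at least [alpha - c] forces a pattern value above [alpha - 2 * c]. The gap below [alpha]
    pushes it above [alpha], and the gap above then to [alpha + c]. *)
Lemma strong_jump12 alpha : 0 <= alpha <= 2 -> ~ critical alpha ->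
  strong_jump [fset 1%N; 2%N]%fset alpha.
Proof.
move=> /[dup] /andP[a0 _] a02 na; split; first by rewrite card_fset12.
have [c1 c10 h1] := pattern_value_gap_above alpha.
have [c2 c20 h2] := pattern_value_gap_below na.
pose c := Num.min c1 (c2 / 2); have c0 : 0 < c by rewrite lt_min c10 divr_gt0.
have cc1 : c <= c1 by rewrite ge_min lexx.
have cc2 : c <= c2 / 2 by rewrite ge_min lexx orbT.
(* The pattern of one loopless part has value [0 <= alpha], so the gap below [alpha] gives
   [c2 <= alpha]. *)
have s0 : 0 <= alpha - 2 * c.
  have v0 : pattern_value K 0 1 = 0 by rewrite /pattern_value invr1 subrr.
  by have := h2 0%N 1%N isT; rewrite v0 => /(_ a0); lra.
exists c => // t; rewrite fset_max12 => t2.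
have [n0 H] := dense_pattern s0 c0 t2; exists n0 => n T G nn GR cG hG.
have [||p [q [pq0 apq]]] := H T G GR; [by rewrite cG|by lra|].
apply: contains_dense_leq; rewrite ?t2 //=.
have [/(h2 _ _ pq0)|/(h1 _ _ pq0)] := leP (pattern_value K p q) alpha; lra.
Qed.

Lemma critical_not_strong alpha :
  critical alpha -> ~ strong_jump [fset 1%N; 2%N]%fset alpha.
Proof.
have lower_not k : ~ strong_jump [fset 1%N; 2%N]%fset (lower k).
  by rewrite -pattern_value_lower; apply: pattern_value_not_strong.
have middle_not k : ~ strong_jump [fset 1%N; 2%N]%fset (middle k).
  by rewrite -pattern_value_middle; apply: pattern_value_not_strong.
have upper_not k : ~ strong_jump [fset 1%N; 2%N]%fset (upper k).
  by rewrite -(pattern_value_upper k 0); apply: pattern_value_not_strong.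
have limit_not (L b : K) j : 0 < b -> 0 < L <= 2 ->
    (forall k, ~ strong_jump [fset 1%N; 2%N]%fset (approach L b j k)) ->
    ~ strong_jump [fset 1%N; 2%N]%fset L.
  move=> b0 /andP[L0 L2] nots; apply: not_strong_jump_closed => d d0.
  (* Taking the minimum with [L] keeps the approximating term nonnegative. *)
  have lt : L - Num.min d L < L by rewrite gtrBl lt_min d0.
  have [k hk] := @approach_cvg K L b j _ lt; have hL := @approach_lt K L b j b0 k.
  have m1 : Num.min d L <= d by rewrite ge_min lexx.
  have m2 : Num.min d L <= L by rewrite ge_min lexx orbT.
  by exists (approach L b j k); [apply/andP; split; lra|split=> //; apply/andP; split; lra].
move=> /criticalP [[k]|]; rewrite !inE => /or3P[] /eqP -> //.
- by apply: (limit_not 1 1 0%N) => //; lra.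
- by apply: (limit_not (5 / 4) (1 / 4) 0%N) => //; lra.
- by apply: (limit_not 2 1 1%N) => //; lra.
Qed.

End JumpsOneTwo.

Theorem theorem3 (K : realType) :
  (forall alpha : K, 0 <= alpha <= 2 -> jump [fset 1%N; 2%N]%fset alpha) /\
  (forall alpha : K, weak_jump [fset 1%N; 2%N]%fset alpha <->
     (alpha = 0
      \/ (exists2 k : nat, (1 <= k)%N & alpha = k%:R / (k%:R + 1))
      \/ alpha = 1
      \/ (exists2 k : nat, (1 <= k)%N & alpha = 1 + k%:R / (4 * (k%:R + 1)))
      \/ alpha = 5 / 4
      \/ (exists2 k : nat, (1 <= k)%N & alpha = (2 * k%:R + 1) / (k%:R + 1))
      \/ alpha = 2)).
Proof.
split=> [alpha|alpha]; first exact: jump12.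
rewrite -/(critical alpha); split.
  move=> [[a02 _] nstrong]; apply: contrapT => na; apply: nstrong.
  by apply: strong_jump12 => //; rewrite card_fset12 in a02.
move=> ca; split; last exact: critical_not_strong.
apply: jump12; move/criticalP: ca.
(* The sequence increases, so nonnegativity is a matter of index [0] only. *)
have bounds (L b : K) j k : 0 < b -> b / j.+1%:R <= L -> L <= 2 ->
    0 <= approach L b j k <= 2.
  move=> b0 bL L2; have := @approach_lt K L b j b0 k => lt; apply/andP; split; last by lra.
  apply: le_trans (@approach_homo K L b j b0 0 k (leq0n k)).
  by rewrite /approach add0n subr_ge0.
by move=> [[k]|]; rewrite !inE => /or3P[] /eqP ->; try (apply: bounds); lra.
Qed.
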